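(* Let $S$ be an $n$-dimensional simplex in Euclidean $n$-space $\mathbb{R}^n$ with vertices $s_0=0,s_1,\dots,s_n$. Let $H$ be a hyperplane through $s_0=0$ with unit normal vector $u$ such that $s_1,\dots,s_n$ lie in the half-space $H^+=\{x:\langle u,x\rangle>0\}$, and let $S^H$ be the image of $S$ under reflection in $H$. Let $s=\sum_{i=1}^n s_i$, let $M=[s_1,\dots,s_n]$ be the matrix with columns $s_i$, and let $G=M^TM$ be the Gram matrix of $\{s_1,\dots,s_n\}$. If the only upper facet of $S$ with respect to $H$ is $F_0=\mathrm{conv}\{s_1,\dots,s_n\}$, with outward unit normal vector $u_0$, then $$\frac{1}{\mathrm{Vol}_n(S)}\,\mathrm{Vol}(\mathrm{conv}(S\cup S^H))\le n\left(1+\frac{\|s\|}{\langle u_0,s\rangle}\right)=n+\sqrt{\left\|(1,\dots,1)G^{-1}\right\|_1}\,\left\|M(1,\dots,1)^T\right\|.$$ Equality is attained in the inequality if and only if the normal vector $u$ of $H$ is equal to $\frac{u_0+s'}{\|u_0+s'\|}$, where $s'=\frac{s}{\|s\|}$.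
   Context: $\mathrm{Vol}=\mathrm{Vol}_n$ is $n$-dimensional volume, $\mathrm{conv}$ is the convex hull, $\langle\cdot,\cdot\rangle$ is the Euclidean inner product, $\|\cdot\|$ is the Euclidean norm, and $\|\cdot\|_1$ is the $l_1$ norm of a vector. For $0\le i\le n$, $F_i$ denotes the facet of $S$ opposite to the vertex $s_i$ and $u_i$ its outward unit normal. The upper facets of $S$ (with respect to $H$, imagined horizontal with $H^+$ above it) are those facets at which lines orthogonal to $H$, coming from far away in $H^+$, first meet $S$ (at relative interior points of the facet); equivalently, $F_i$ is an upper facet if and only if $\langle u_i,u\rangle>0$.
   Formalization: The identity with the l1 norm of (1,…,1)G^{-1} is false in general (s_1=(1,0), s_2=(2,1), u=(3,1)/√10); proved instead with the sum of its entries, and as ''≤'' with the l1 norm, with equality iff all entries are nonnegative. *)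

(* Defs.v *)
From HB Require Import structures.
From mathcomp Require Import all_boot all_order all_algebra.
From mathcomp Require Import all_classical all_reals all_analysis.

Set Implicit Arguments.
Unset Strict Implicit.
Unset Printing Implicit Defensive.

Import Order.TTheory GRing.Theory Num.Theory.
Import numFieldNormedType.Exports.

Local Open Scope classical_set_scope.
Local Open Scope ring_scope.

(* The norm `|x| that the library puts on matrices is the sup norm, hence the
   explicit Euclidean and l1 norms below. *)
Section Euclidean.
Context {R : realType} {n : nat}.

Definition dot (x y : 'cV[R]_n) : R := \sum_(i < n) x i 0 * y i 0.

Definition enorm (x : 'cV[R]_n) : R := Num.sqrt (dot x x).

Definition l1norm (x : 'rV[R]_n) : R := \sum_(j < n) `|x 0 j|.

(* The hyperplane is { y | dot u y = 0 }, with u a unit vector. *)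
Definition reflection (u x : 'cV[R]_n) : 'cV[R]_n := x - (2 * dot u x) *: u.

End Euclidean.

Section Volume.
Context {R : realType}.

(* The n-fold product of the Lebesgue measure on the real line; the library's
   product sigma-algebra on n-tuples is its domain of measurability. *)
Fixpoint lebesgue_tuple (n : nat) :
    set (n.-tuple (measurableTypeR R)) -> \bar R :=
  match n with
  | 0 => @dirac _ (0.-tuple (measurableTypeR R)) [tuple] R
  | n'.+1 => pushforward (@lebesgue_measure R \x @lebesgue_tuple n')%E
               (fun p => [tuple of p.1 :: p.2])
  end.

Definition Vol (n : nat) (A : set 'cV[R]_n) : \bar R :=
  lebesgue_tuple [set t : n.-tuple (measurableTypeR R) |
                   A (\col_i (tnth t i : R))].

End Volume.

Section Hulls.
Context {R : realType} {n : nat}.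
Implicit Types A : set 'cV[R]_n.

Definition convex_hull A : set 'cV[R]_n :=
  smallest (@convex_set R 'cV[R]_n) A.

Definition affine_set A : Prop :=
  forall x y (t : R), A x -> A y -> A (t *: x + (1 - t) *: y).

Definition affine_hull A : set 'cV[R]_n := smallest affine_set A.

Definition relint A : set 'cV[R]_n :=
  [set x | A x /\ \forall y \near x, affine_hull A y -> A y].

End Hulls.

Section Simplex.
Context {R : realType} {n : nat}.
Implicit Types (s : 'I_n.+1 -> 'cV[R]_n) (S F : set 'cV[R]_n) (u : 'cV[R]_n).

Definition affinely_independent s : Prop :=
  forall c : 'I_n.+1 -> R,
    \sum_i c i = 0 -> \sum_i c i *: s i = 0 -> forall i, c i = 0.

Definition simplex s : set 'cV[R]_n := convex_hull (range s).

Definition facet s (i : 'I_n.+1) : set 'cV[R]_n :=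
  convex_hull (s @` [set j | j != i]).

(* F is cut out of S by the supporting hyperplane { x | dot u x = b }. *)
Definition outward_unit_normal S F u : Prop :=
  enorm u = 1 /\
  exists b : R, S `<=` [set x | dot u x <= b] /\
                F = S `&` [set x | dot u x = b].

(* Some line { x + t *: u | t : R }, followed from t = +oo downwards, first
   meets S at a relative interior point x of F. *)
Definition upper_facet S u F : Prop :=
  exists x, [/\ relint F x, S x & forall t : R, 0 < t -> ~ S (x + t *: u)].

End Simplex.

(* Main.v *)
Require Import Defs.
From HB Require Import structures.
From mathcomp Require Import all_boot all_order all_algebra.
From mathcomp Require Import all_classical all_reals all_analysis.
From mathcomp Require Import measurable_realfun lra ring.

Set Implicit Arguments.
Unset Strict Implicit.
Unset Printing Implicit Defensive.

Import Order.TTheory GRing.Theory Num.Theory.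
Import numFieldNormedType.Exports.

Local Open Scope classical_set_scope.
Local Open Scope ring_scope.

(** Let M be the matrix with columns s_1, ..., s_n, so that S is the image
    under M of the standard simplex, and let u = M lambda.

    Shape of the hull.  If lambda_i < 0, then moving up from an interior point
    of F_i makes the i-th coordinate negative, so F_i is an upper facet
    ([upper_facet_lift]).  The hypothesis therefore gives lambda >= 0: the
    vertical ray issued from 0 stays in S until it meets F_0.  Hence 0 lies on
    the vertical segment joining a point of F_0 to its mirror image, and
    conv(S u S^H) is the union of all such segments over F_0
    ([convex_hull_reflection]).

    Volume of the hull.  Use as coordinates the depth t below F_0 and the
    barycentric coordinates in F_0.  In these coordinates the hull is the
    region under the graph of the affine function with value 2 <u, s_j> at the
    j-th vertex of a standard simplex, and the coordinate change has
    determinant - det M * sum lambda ([det_prism_mx]).  By linearity of the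
    integral it is enough to know the region under the graph of a single
    barycentric coordinate; that region is a shear of the standard simplex of
    one dimension more ([Vol_hypograph_bary]).  So both volumes are multiples
    of the volume of the standard n-simplex, whose value cancels:
      Vol(conv(S u S^H)) / Vol(S) = 2 (sum lambda) <u, s>
                                  = 2 n <u0, u> <u, s> / <u0, s>,
    where the first equality is [Vol_hull_ratio] and the second holds because
    <u0, s_j> does not depend on j.

    Choice of u.  The vector r = 2 <u, s> u - s is the mirror image of s in the
    line spanned by u, so its norm is that of s, and
    2 <u0, u> <u, s> = <u0, s> + <u0, r> <= <u0, s> + |s|, with equality exactly
    when r = |s| u0, that is, when u bisects the angle between u0 and s
    ([bisector_bound], [bisector_bound_eq], [bisector_direction]).

    The change of variables formula is proved for the iterated product
    measure by induction on the dimension: an invertible matrix of size 1 + n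
    is a product of three shears and a block diagonal matrix
    ([Vol_scaling_unit]). *)

(** * Lebesgue measure on tuples *)

Section SigmaFiniteMeasurePacking.
Context d (T : measurableType d) (R : realType) (m : set T -> \bar R).
Hypotheses (m0 : m set0 = 0%E) (m_ge0 : forall A, (0 <= m A)%E).
Hypotheses (m_additive : semi_sigma_additive m) (m_finite : sigma_finite setT m).

#[local] HB.instance Definition _ := isMeasure.Build d T R m m0 m_ge0 m_additive.
#[local] HB.instance Definition _ := Measure_isSigmaFinite.Build d T R m m_finite.

(** Turns the two conditions on a set function, being a measure and being
    sigma-finite, into one structure; this form can be carried through an
    induction. *)
Lemma sigma_finite_measure_exists :
  exists mu : {sigma_finite_measure set T -> \bar R}, (mu : set T -> \bar R) = m.
Proof. by exists m. Qed.

End SigmaFiniteMeasurePacking.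

Section TupleMeasure.
Context {R : realType}.
Local Notation mR := (measurableTypeR R).

Lemma measurable_tuple_cons n :
  measurable_fun setT (fun p : mR * n.-tuple mR => [tuple of p.1 :: p.2]).
Proof. exact: measurable_cons. Qed.

(** Induction on the dimension: the product of two measures is a measure only
    when the second one is sigma-finite, so both properties have to be proved
    together. The covering in dimension n + 1 consists of the products of the
    sets covering the line and the n-dimensional tuples. *)
Lemma lebesgue_tuple_sigma_finite_measure n :
  exists mu : {sigma_finite_measure set (n.-tuple mR) -> \bar R},
    (mu : set _ -> \bar R) = @lebesgue_tuple R n.
Proof.
elim: n => [|n [mu muE]].
  by exists (@dirac _ (0.-tuple mR) [tuple] R).
pose f (p : mR * n.-tuple mR) : n.+1.-tuple mR := [tuple of p.1 :: p.2].
pose nu := pushforward (@lebesgue_measure R \x mu)%E f.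
have mf : measurable_fun setT f by exact: measurable_tuple_cons.
have sf : sigma_finite setT nu.
  have /sigma_finiteP[A [AT ndA Aoo]] := sigma_finiteT (@lebesgue_measure R).
  have /sigma_finiteP[B [BT ndB Boo]] := sigma_finiteT mu.
  exists (fun k => [set t : n.+1.-tuple mR |
    (A k `*` B k) (thead t, [tuple of behead t])]).
    apply/esym; rewrite -subTset => t _.
    have : [set: mR] (thead t) by []; have : setT [tuple of behead t] by [].
    rewrite AT BT => -[j _ Bj] [i _ Ai]; exists (maxn i j) => //; split => /=.
      by move: (thead t) Ai; apply/subsetPset/ndA/leq_maxl.
    by move: [tuple of _] Bj; apply/subsetPset/ndB/leq_maxr.
  move=> k; have [mA Akoo] := Aoo k; have [mB Bkoo] := Boo k; split.
    rewrite -[X in measurable X]setTI.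
    pose g (t : n.+1.-tuple mR) : mR * n.-tuple mR := (thead t, [tuple of behead t]).
    have mg : measurable_fun setT g.
      apply: measurable_fun_pair; first exact: measurable_tnth.
      exact: measurable_behead.
    by apply: (mg measurableT (A k `*` B k)); exact: measurableX.
  rewrite /nu /pushforward (_ : _ @^-1` _ = A k `*` B k); last first.
    have fK x y : [tuple of behead (f (x, y))] = y by exact: val_inj.
    by apply/seteqP; split=> -[x y] /=; rewrite fK.
  by rewrite product_measure1E// lte_mul_pinfty// ge0_fin_numE.
(* The measure structure of a pushforward depends on a proof that the map is
   measurable. *)
have [m mE] : exists m : {measure set (n.+1.-tuple mR) -> \bar R},
    (m : set _ -> \bar R) = nu.
  by unshelve eexists nu => //; exact: mf.
rewrite (_ : lebesgue_tuple (n := _) = nu); last by rewrite /nu muE.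
apply: sigma_finite_measure_exists; rewrite -?mE//.
  exact: measure_semi_sigma_additive.
by rewrite mE.
Qed.

Let lebesgue_tuple0 n : @lebesgue_tuple R n set0 = 0%E.
Proof. by have [mu <-] := lebesgue_tuple_sigma_finite_measure n. Qed.

Let lebesgue_tuple_ge0 n A : (0 <= @lebesgue_tuple R n A)%E.
Proof. by have [mu <-] := lebesgue_tuple_sigma_finite_measure n. Qed.

Let lebesgue_tuple_sigma_additive n : semi_sigma_additive (@lebesgue_tuple R n).
Proof.
have [mu <-] := lebesgue_tuple_sigma_finite_measure n.
exact: measure_semi_sigma_additive.
Qed.

HB.instance Definition _ n := isMeasure.Build _ _ _ (@lebesgue_tuple R n)
  (@lebesgue_tuple0 n) (@lebesgue_tuple_ge0 n)
  (@lebesgue_tuple_sigma_additive n).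

Let lebesgue_tuple_sigma_finite n : sigma_finite setT (@lebesgue_tuple R n).
Proof.
have [mu <-] := lebesgue_tuple_sigma_finite_measure n.
exact: sigma_finiteT.
Qed.

HB.instance Definition _ n := Measure_isSigmaFinite.Build _ _ _
  (@lebesgue_tuple R n) (@lebesgue_tuple_sigma_finite n).

End TupleMeasure.

(** * Affine maps of the line *)

Section LineAffine.
Context {R : realType}.
Local Notation mR := (measurableTypeR R).
Local Notation lambda := (@lebesgue_measure R).

Lemma measurable_affine (a b : R) :
  measurable_fun setT (fun x : mR => (a * x + b : mR)).
Proof. by apply: measurable_funD => //; exact: measurable_funM. Qed.

(** Lebesgue measure is determined by its values on the intervals ]c, d], and
    the preimage of such an interval is an interval of length (d - c) / |a|;
    for a < 0 it is closed on the left instead of on the right. *)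
Lemma lebesgue_measure_affine (a b : R) (X : set mR) :
  a != 0 -> measurable X ->
  lambda [set x | X (a * x + b)] = ((`|a|^-1)%:E * lambda X)%E.
Proof.
move=> a0 mX.
pose f (x : mR) : mR := a * x + b.
have mf : measurable_fun setT f by exact: measurable_affine.
have [nu nuE] : exists nu : {measure set mR -> \bar R},
    (nu : set mR -> \bar R) = pushforward lambda f.
  by unshelve eexists (pushforward lambda f) => //; exact: mf.
have key : lambda X = mscale (`|a|%:nng) nu X.
  apply: lebesgue_measure_unique => // _ [[c d] _ <-] /=.
  rewrite /mscale nuE /pushforward /=.
  have [{}a0|{}a0|/eqP] := ltgtP 0 a; last by rewrite eq_sym (negPf a0).
    rewrite (_ : _ @^-1` _ = `](c - b) / a, (d - b) / a]%classic); last first.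
      apply/seteqP; split=> x; rewrite /= /f !in_itv/= ltr_pdivrMr// ler_pdivlMr//;
        rewrite ltrBlDr lerBrDr mulrC//.
    rewrite !lebesgue_measure_itv/= !lte_fin ltr_pM2r ?invr_gt0// ltrD2r.
    case: ifP => _; rewrite ?mule0// -!EFinB -EFinM; congr (_%:E).
    by rewrite gtr0_norm//; field; rewrite gt_eqF.
  rewrite (_ : _ @^-1` _ = `[(d - b) / a, (c - b) / a[%classic); last first.
    apply/seteqP; split=> x; rewrite /= /f !in_itv/= ltr_ndivlMr// ler_ndivrMr//;
      rewrite ltrBlDr lerBrDr mulrC andbC//.
  rewrite !lebesgue_measure_itv/= !lte_fin ltr_nM2r ?invr_lt0// ltrD2r.
  case: ifP => _; rewrite ?mule0// -!EFinB -EFinM; congr (_%:E).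
  by rewrite ltr0_norm//; field; rewrite lt_eqF.
rewrite key /mscale nuE /pushforward muleA -EFinM /= mulVf ?mul1e//.
by rewrite normr_eq0.
Qed.

Lemma ge0_integral_affine (a b : R) (f : mR -> \bar R) :
  a != 0 -> measurable_fun setT f -> (forall x, 0 <= f x)%E ->
  (\int[lambda]_x f (a * x + b)%R = (`|a|^-1)%:E * \int[lambda]_x f x)%E.
Proof.
move=> a0 mf f0.
pose phi (x : mR) : mR := a * x + b.
have mphi : measurable_fun setT phi by exact: measurable_affine.
have a1 : 0 <= `|a|^-1 by rewrite invr_ge0.
rewrite -(@ge0_integral_mscale _ _ _ lambda _ measurableT (NngNum a1))//.
rewrite -[LHS](@ge0_integral_pushforward _ _ _ _ _ _ mphi lambda setT)//.
apply: eq_measure_integral => A mA _; exact: lebesgue_measure_affine.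
Qed.

End LineAffine.

(** * Measurable sets of columns and their slices *)

Section ColumnMeasure.
Context {R : realType}.
Local Notation mR := (measurableTypeR R).
Local Notation lambda := (@lebesgue_measure R).

(** [Vol] reads a set of columns as a set of tuples, the domain of
    [lebesgue_tuple]; measurability of sets and functions on columns is defined
    through the same identification. *)
Definition col_of_tuple n (t : n.-tuple mR) : 'cV[R]_n := \col_i tnth t i.

Definition col_measurable n (A : set 'cV[R]_n) :=
  measurable (@col_of_tuple n @^-1` A).

Definition col_measurable_fun n (f : 'cV[R]_n -> R) :=
  measurable_fun setT (f \o @col_of_tuple n : _ -> mR).

Lemma col_measurable_fun_coord n (i : 'I_n) :
  col_measurable_fun (fun y => y i 0).
Proof.
rewrite /col_measurable_fun (_ : _ \o _ = fun t => tnth t i).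
  exact: measurable_tnth.
by apply/funext => t /=; rewrite mxE.
Qed.

Lemma col_measurable_fun_sum n (I : Type) (r : seq I) (f : I -> 'cV[R]_n -> R) :
  (forall i, col_measurable_fun (f i)) ->
  col_measurable_fun (fun y => \sum_(i <- r) f i y).
Proof. by move=> mf; apply: (@measurable_sum _ _ R setT _ r). Qed.

Lemma col_measurable_fun_mulmx n m (A : 'M[R]_(m, n)) i :
  col_measurable_fun (fun y => (A *m y) i 0).
Proof.
rewrite (_ : (fun y : 'cV_n => _) = fun y => \sum_j A i j * y j 0).
  apply: col_measurable_fun_sum => j; apply: measurable_funM => //.
  exact: col_measurable_fun_coord.
by apply/funext => y; rewrite mxE.
Qed.

Lemma col_measurable_preimage n m (g : 'cV[R]_n -> 'cV[R]_m) X :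
  (forall i, col_measurable_fun (fun y => g y i 0)) ->
  col_measurable X -> col_measurable (g @^-1` X).
Proof.
move=> mg mX; pose h (t : n.-tuple mR) : m.-tuple mR :=
  [tuple g (col_of_tuple t) i 0 | i < m].
have mh : measurable_fun setT h.
  apply/measurable_fun_tnthP => i.
  rewrite (_ : _ \o _ = (fun y => g y i 0) \o @col_of_tuple n); first exact: mg.
  by apply/funext => t /=; rewrite tnth_mktuple.
have := mh measurableT _ mX; rewrite setTI; congr measurable.
have hE t : col_of_tuple (h t) = g (col_of_tuple t).
  by apply/colP => i; rewrite mxE tnth_mktuple.
by apply/seteqP; split=> t /=; rewrite hE.
Qed.

Lemma col_measurable_affine n m (A : 'M[R]_(m, n)) b X :
  col_measurable X -> col_measurable [set y | X (A *m y + b)].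
Proof.
apply: col_measurable_preimage => i.
rewrite (_ : (fun y => _) = (fun y => (A *m y) i 0 + b i 0)); last first.
  by apply/funext => y; rewrite mxE.
by apply: measurable_funD => //; exact: col_measurable_fun_mulmx.
Qed.

Lemma col_measurable_lin n m (A : 'M[R]_(m, n)) X :
  col_measurable X -> col_measurable [set y | X (A *m y)].
Proof.
move=> /(col_measurable_affine A 0); congr col_measurable.
by apply/seteqP; split=> y /=; rewrite addr0.
Qed.

Lemma col_measurable_le n (f g : 'cV[R]_n -> R) :
  col_measurable_fun f -> col_measurable_fun g ->
  col_measurable [set y | f y <= g y].
Proof.
move=> mf mg.
have mfg := @measurable_fun_ler _ _ R setT _ _ mf mg.
have := mfg measurableT [set true] I; rewrite setTI; congr measurable.
Qed.

Lemma col_measurableI n (A B : set 'cV[R]_n) :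
  col_measurable A -> col_measurable B -> col_measurable (A `&` B).
Proof. exact: measurableI. Qed.

Lemma col_measurable_forall n m (A : 'I_m -> set 'cV[R]_n) :
  (forall i, col_measurable (A i)) -> col_measurable [set y | forall i, A i y].
Proof.
move=> mA.
rewrite /col_measurable (_ : _ @^-1` _ = \bigcap_(i in setT) (@col_of_tuple n @^-1` A i)).
  by apply: fin_bigcap_measurable => // i _; exact: mA.
by apply/seteqP; split=> t /= h i => [_|]; exact: h.
Qed.

Definition slice n (A : set 'cV[R]_(1 + n)) (x : R) : set 'cV[R]_n :=
  [set y | A (col_mx x%:M y)].

Lemma col_of_tuple_cons n x (t : n.-tuple mR) :
  col_of_tuple [tuple of x :: t] = col_mx x%:M (col_of_tuple t) :> 'cV[R]_(1 + n).
Proof.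
apply/colP => i; rewrite !mxE; case: splitP => j /= ij.
  rewrite (_ : i = ord0) ?tnth0 ?ord1 ?mxE//.
  by apply/val_inj; rewrite /= ij ord1.
rewrite (_ : i = lift ord0 j) ?tnthS ?mxE//; exact/val_inj.
Qed.

Let pairs n (A : set 'cV[R]_(1 + n)) : set (mR * n.-tuple mR) :=
  (fun p : mR * n.-tuple mR => [tuple of p.1 :: p.2]) @^-1` (@col_of_tuple n.+1 @^-1` A).

Let xsection_pairs n (A : set 'cV[R]_(1 + n)) x :
  xsection (pairs A) x = @col_of_tuple n @^-1` slice A x.
Proof.
by apply/seteqP; split=> t; rewrite /xsection /slice /= inE /pairs/= col_of_tuple_cons.
Qed.

Let ysection_pairs n (A : set 'cV[R]_(1 + n)) t :
  ysection (pairs A) t = [set x | A (col_mx x%:M (col_of_tuple t))].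
Proof.
by apply/seteqP; split=> x; rewrite /ysection /= inE /pairs/= col_of_tuple_cons.
Qed.

Let measurable_pairs n (A : set 'cV[R]_(1 + n)) :
  col_measurable A -> measurable (pairs A).
Proof.
move=> mA; have := @measurable_tuple_cons R n measurableT _ mA.
by rewrite setTI.
Qed.

Lemma col_measurable_slice n (A : set 'cV[R]_(1 + n)) x :
  col_measurable A -> col_measurable (slice A x).
Proof.
move=> /measurable_pairs mA; rewrite /col_measurable -xsection_pairs.
exact: measurable_xsection.
Qed.

Lemma measurable_fiber n (A : set 'cV[R]_(1 + n)) (t : n.-tuple mR) :
  col_measurable A ->
  measurable [set x : mR | A (col_mx x%:M (col_of_tuple t))].
Proof.
by move=> /measurable_pairs mA; rewrite -ysection_pairs; exact: measurable_ysection.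
Qed.

Lemma Vol_slices n (A : set 'cV[R]_(1 + n)) :
  Vol A = (\int[lambda]_x Vol (slice A x))%E.
Proof. by apply: eq_integral => x _ /=; rewrite -/(pairs A) xsection_pairs. Qed.

Lemma measurable_Vol_slice n (A : set 'cV[R]_(1 + n)) :
  col_measurable A -> measurable_fun setT (fun x : mR => Vol (slice A x)).
Proof.
move=> /measurable_pairs mA.
have := measurable_fun_xsection (@lebesgue_tuple R n) mA.
by congr measurable_fun; apply/funext => x /=; rewrite xsection_pairs.
Qed.

(** Fubini: the first coordinate is integrated first. With [Vol_slices] this
    makes it possible to integrate first over the variables that a shear
    translates. *)
Lemma Vol_fibers n (A : set 'cV[R]_(1 + n)) : col_measurable A ->
  Vol A = (\int[@lebesgue_tuple R n]_t
             lambda [set x | A (col_mx x%:M (col_of_tuple t))])%E.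
Proof.
move=> /measurable_pairs mA.
rewrite [LHS](@product_measure_unique _ _ _ _ _ lambda (@lebesgue_tuple R n)
  (lambda \x^ @lebesgue_tuple R n)%E)//.
  by apply: eq_integral => t _ /=; rewrite ysection_pairs.
by move=> B C mB mC; exact: product_measure2E.
Qed.

Lemma le_Vol n (A B : set 'cV[R]_n) :
  col_measurable A -> col_measurable B -> A `<=` B -> (Vol A <= Vol B)%E.
Proof.
by move=> mA mB AB; apply: le_measure; rewrite ?inE//; move=> t; exact: AB.
Qed.

End ColumnMeasure.

(** * Linear change of variables *)

Section ChangeOfVariables.
Context {R : realType}.
Local Notation mR := (measurableTypeR R).
Local Notation lambda := (@lebesgue_measure R).

Lemma scalar_mx11D (a : R) (B : 'M[R]_1) : (a + B 0 0)%:M = a%:M + B :> 'M[R]_1.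
Proof. by apply/matrixP => i j; rewrite !mxE !ord1 eqxx. Qed.

(** Slice by slice, the tail of b is handled by induction and its first entry by
    translation invariance on the line. *)
Lemma Vol_translation n (b : 'cV[R]_n) X :
  col_measurable X -> Vol [set y | X (y + b)] = Vol X.
Proof.
elim: n b X => [|n IHn] b X mX.
  by congr Vol; apply/seteqP; split=> y /=; rewrite (flatmx0 b) addr0.
rewrite -[n.+1]/(1 + n)%N in b X mX *.
rewrite -(vsubmxK b); set b1 := usubmx _; set b2 := dsubmx _.
rewrite Vol_slices (Vol_slices X).
under eq_integral => x _.
  rewrite (_ : slice _ _ = [set y | slice X (1 * x + b1 0 0) (y + b2)]); last first.
    apply/seteqP; split=> y; rewrite /slice /= add_col_mx mul1r scalar_mx11D//.
  rewrite IHn; last exact: col_measurable_slice.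
  over.
rewrite (@ge0_integral_affine _ 1 (b1 0 0) (fun x => Vol (slice X x)))//.
- by rewrite normr1 invr1 mul1e.
- exact: measurable_Vol_slice.
Qed.

Definition Vol_scaling n (A : 'M[R]_n) := forall X, col_measurable X ->
  Vol [set y | X (A *m y)] = ((`|\det A|^-1)%:E * Vol X)%E.

Lemma Vol_scalingM n (A B : 'M[R]_n) :
  Vol_scaling A -> Vol_scaling B -> Vol_scaling (A *m B).
Proof.
move=> sA sB X mX.
rewrite (_ : [set y | _] = [set y | [set z | X (A *m z)] (B *m y)]); last first.
  by apply/seteqP; split=> y /=; rewrite mulmxA.
rewrite sB; last exact: col_measurable_lin.
by rewrite sA// muleA -EFinM det_mulmx normrM invfM mulrC.
Qed.

(** On each line parallel to the first axis this shear is a translation. *)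
Lemma Vol_scaling_upper_shear n (r : 'rV[R]_n) :
  Vol_scaling (block_mx 1%:M r 0 1%:M : 'M[R]_(1 + n)).
Proof.
move=> X mX; rewrite det_ublock !det1 mulr1 normr1 invr1 mul1e.
rewrite Vol_fibers; last exact: col_measurable_lin.
rewrite (Vol_fibers mX); apply: eq_integral => t _.
set y := col_of_tuple t.
rewrite (_ : [set x | _] = [set x | [set x | X (col_mx x%:M y)]
                                     (1 * x + (r *m y) 0 0)]); last first.
  apply/seteqP; split=> x /=;
    by rewrite mul_block_col !mul1mx mul0mx add0r mul1r scalar_mx11D.
rewrite lebesgue_measure_affine//; last exact: measurable_fiber.
by rewrite normr1 invr1 mul1e.
Qed.

(** On each hyperplane where the first coordinate is constant this shear is a
    translation. *)
Lemma Vol_scaling_lower_shear n (c : 'cV[R]_n) :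
  Vol_scaling (block_mx 1%:M 0 c 1%:M : 'M[R]_(1 + n)).
Proof.
move=> X mX; rewrite det_lblock !det1 mulr1 normr1 invr1 mul1e.
rewrite Vol_slices (Vol_slices X); apply: eq_integral => x _.
rewrite -[RHS](Vol_translation (c *m x%:M)); last exact: col_measurable_slice.
congr Vol; apply/seteqP; split=> y;
  by rewrite /slice /= mul_block_col !mul1mx mul0mx addr0 addrC.
Qed.

Lemma Vol_scaling_diag n (a : R) (D : 'M[R]_n) : a != 0 ->
  Vol_scaling D -> Vol_scaling (block_mx a%:M 0 0 D : 'M[R]_(1 + n)).
Proof.
move=> a0 sD X mX; rewrite det_ublock det_scalar1 normrM invfM.
rewrite Vol_slices (Vol_slices X).
under eq_integral => x _.
  rewrite (_ : slice _ _ = [set y | slice X (a * x + 0) (D *m y)]); last first.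
    apply/seteqP; split=> y;
    by rewrite /slice /= mul_block_col !mul0mx addr0 add0r addr0 -scalar_mxM.
  rewrite sD; last exact: col_measurable_slice.
  over.
rewrite ge0_integralZl//; last first.
  apply: (@measurableT_comp _ _ _ _ _ _ (fun x : mR => Vol (slice X x))
    _ (fun x : mR => a * x + 0 : mR)).
    exact: measurable_Vol_slice.
  exact: measurable_affine.
rewrite (@ge0_integral_affine _ a 0 (fun x => Vol (slice X x)))//.
- by rewrite muleA -EFinM mulrC.
- exact: measurable_Vol_slice.
Qed.

(** One step of Gaussian elimination: clearing the first column and the first
    row with a nonzero pivot costs one shear on each side. *)
Lemma Vol_scaling_pivot n (a : R) (b : 'rV[R]_n) (c : 'cV[R]_n) D : a != 0 ->
  (forall D' : 'M[R]_n, \det D' != 0 -> Vol_scaling D') ->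
  \det (block_mx a%:M b c D : 'M[R]_(1 + n)) != 0 ->
  Vol_scaling (block_mx a%:M b c D : 'M[R]_(1 + n)).
Proof.
move=> a0 IHn; set D' := D - c *m (a^-1 *: b).
have -> : block_mx a%:M b c D = (block_mx 1%:M 0 (a^-1 *: c) 1%:M : 'M[R]_(1 + n)) *m
    ((block_mx a%:M 0 0 D' : 'M[R]_(1 + n)) *m block_mx 1%:M (a^-1 *: b) 0 1%:M).
  rewrite !mulmx_block !(mulmx0, mul0mx, mulmx1, mul1mx, addr0, add0r).
  rewrite mul_scalar_mx scalerA divff// scale1r mul_mx_scalar scalerA divff// scale1r.
  by rewrite /D' -scalemxAr -scalemxAl addrC subrK.
rewrite !det_mulmx det_ublock det_lblock det_ublock !det1 !mulr1 !mul1r.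
rewrite mulf_eq0 negb_or => /andP[_ D0].
apply: Vol_scalingM; first exact: Vol_scaling_lower_shear.
apply: Vol_scalingM; last exact: Vol_scaling_upper_shear.
by apply: Vol_scaling_diag => //; exact: IHn.
Qed.

(** When the upper left entry of A vanishes, adding a suitable other row to the
    first one produces a nonzero pivot; this is one more shear, and avoids
    permutation matrices. *)
Lemma Vol_scaling_unit n (A : 'M[R]_n) : \det A != 0 -> Vol_scaling A.
Proof.
elim: n A => [|n IHn] A.
  move=> _ X mX; rewrite det_mx00 normr1 invr1 mul1e; congr Vol.
  by apply/seteqP; split=> y /=; rewrite (flatmx0 (A *m y)) (flatmx0 y).
rewrite -[n.+1]/(1 + n)%N in A *.
move=> A0.
have [r r0] : exists r : 'rV[R]_n,
    ulsubmx A 0 0 + (r *m dlsubmx A) 0 0 != 0.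
  have [a0|a0] := eqVneq (ulsubmx A 0 0) 0; last first.
    by exists 0; rewrite mul0mx [X in _ + X]mxE addr0.
  have [c0|/cV0Pn[j cj]] := eqVneq (dlsubmx A) 0.
    move: A0; rewrite -(submxK A) c0 det_ublock.
    by rewrite (mx11_scalar (ulsubmx A)) a0 det_scalar1 mul0r eqxx.
  exists (delta_mx 0 j); rewrite a0 add0r -rowE mxE//.
set a := (X in X != 0) in r0.
have AE : A = (block_mx 1%:M (- r) 0 1%:M : 'M[R]_(1 + n)) *m
   block_mx a%:M (ursubmx A + r *m drsubmx A) (dlsubmx A) (drsubmx A).
  rewrite mulmx_block !(mul0mx, mul1mx, add0r) !mulNmx addrK.
  rewrite /a scalar_mx11D -mx11_scalar addrK submxK//.
rewrite AE; apply: Vol_scalingM; first exact: Vol_scaling_upper_shear.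
apply: Vol_scaling_pivot => //.
by move: A0; rewrite {1}AE det_mulmx det_ublock !det1 !mul1r.
Qed.

Lemma Vol_affine_image n (A : 'M[R]_n) (b : 'cV[R]_n) X :
  \det A != 0 -> col_measurable X ->
  Vol [set A *m y + b | y in X] = (`|\det A|%:E * Vol X)%E.
Proof.
move=> A0 mX.
have uA : A \in unitmx by rewrite unitmxE unitfE.
have -> : [set A *m y + b | y in X] =
    [set z | [set y | X (invmx A *m y)] (z + - b)].
  apply/seteqP; split=> [z /= [y Xy <-]|z /= Xz].
    by rewrite addrK mulKmx.
  by exists (invmx A *m (z - b)) => //; rewrite mulKVmx// subrK.
rewrite Vol_translation; last exact: col_measurable_lin.
rewrite Vol_scaling_unit//; last by rewrite det_inv invr_eq0.
by rewrite det_inv normfV invrK.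
Qed.

End ChangeOfVariables.

(** * The standard simplex and the prism over it *)

Section StandardBodies.
Context {R : realType}.
Local Notation mR := (measurableTypeR R).
Local Notation lambda := (@lebesgue_measure R).

Definition cube n (a : R) : set 'cV[R]_n := [set y | forall i, 0 <= y i 0 <= a].

Arguments cube : clear implicits.

Definition std_simplex n : set 'cV[R]_n :=
  [set y | (forall i, 0 <= y i 0) /\ \sum_i y i 0 <= 1].

Lemma col_measurable_fun_cst n (a : R) : col_measurable_fun (fun=> a : R^o) (n := n).
Proof. exact: measurable_cst. Qed.

Lemma col_measurable_cube n a : col_measurable (cube n a).
Proof.
rewrite (_ : cube n a = [set y | forall i, ([set y : 'cV_n | 0 <= y i 0] `&`
    [set y : 'cV_n | y i 0 <= a]) y]); last first.
  by apply/seteqP; split=> y h i; have := h i; [move/andP|move=> [? ?]; apply/andP].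
apply: col_measurable_forall => i; apply: col_measurableI.
  by apply: col_measurable_le;
    [exact: col_measurable_fun_cst|exact: col_measurable_fun_coord].
by apply: col_measurable_le;
  [exact: col_measurable_fun_coord|exact: col_measurable_fun_cst].
Qed.

Lemma col_measurable_std_simplex n : col_measurable (@std_simplex n).
Proof.
apply: col_measurableI.
  apply: col_measurable_forall => i.
  by apply: col_measurable_le;
    [exact: col_measurable_fun_cst|exact: col_measurable_fun_coord].
apply: col_measurable_le; last exact: col_measurable_fun_cst.
by apply: col_measurable_fun_sum => i; exact: col_measurable_fun_coord.
Qed.

Lemma Vol_cube n a : 0 <= a -> Vol (cube n a) = (a ^+ n)%:E.
Proof.
move=> a0; elim: n => [|n IHn].
  rewrite expr0 /Vol /= diracE.
  by rewrite mem_set// => -[].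
rewrite -[n.+1]/(1 + n)%N Vol_slices.
transitivity (\int[lambda]_x ((\1_(`[0, a]%classic : set mR) x)%:E * (a ^+ n)%:E))%E.
  apply: eq_integral => x _; rewrite indicE -IHn; have [xa|xa] := boolP (x \in _).
    rewrite mul1e; congr Vol; apply/seteqP; split=> y h i.
      by have := h (rshift 1 i); rewrite col_mxEd.
    move: xa; rewrite inE /= in_itv/= => xa.
    by case: (split_ordP i) => j ->; rewrite ?col_mxEd ?col_mxEu// !ord1 mxE eqxx.
  rewrite mul0e (_ : slice _ _ = set0); first exact: measure0.
  apply/seteqP; split=> // y h; move/negP: xa; apply.
  have := h (lshift n ord0); rewrite col_mxEu mxE eqxx => xa.
  by rewrite inE /= in_itv.
rewrite ge0_integralZr//; last 2 first.

- exact/measurable_EFinP/measurable_indic.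
- by rewrite lee_fin exprn_ge0.
rewrite integral_indic// setIT /= lebesgue_measure_itv/= lte_fin.
have [{}a0|a0'] := ltP 0 a; first by rewrite sube0 -EFinM exprS.
have -> : a = 0 by apply/eqP; rewrite eq_le a0' a0.
by rewrite mul0e expr0n.
Qed.

(** The volume cancels in the ratio, so its exact value does not matter: a cube
    inside the simplex is enough here, and a cube around it shows finiteness. *)
Lemma Vol_std_simplex_gt0 n : (0 < Vol (@std_simplex n))%E.
Proof.
(* The side 1 / (n + 1) rather than 1 / n covers dimension 0 as well. *)
have a0 : 0 < n.+1%:R^-1 :> R by rewrite invr_gt0.
apply: (@lt_le_trans _ _ (Vol (cube n n.+1%:R^-1))).
  by rewrite Vol_cube ?ltW// lte_fin exprn_gt0.
apply: le_Vol; [exact: col_measurable_cube|exact: col_measurable_std_simplex|].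
move=> y h; split=> [i|]; first by case/andP: (h i).
apply: (@le_trans _ _ (\sum_(i < n) n.+1%:R^-1)).
  by apply: ler_sum => i _; case/andP: (h i).
by rewrite sumr_const card_ord -[_ *+ _]mulr_natl ler_pdivrMr// mul1r ler_nat.
Qed.

Lemma Vol_std_simplex_lty n : (Vol (@std_simplex n) < +oo)%E.
Proof.
apply: (@le_lt_trans _ _ (Vol (cube n 1))); last by rewrite Vol_cube// ltry.
apply: le_Vol; [exact: col_measurable_std_simplex|exact: col_measurable_cube|].
move=> y [y0 y1] i; rewrite y0 /=; apply: le_trans y1.
by rewrite (bigD1 i)//= lerDl sumr_ge0.
Qed.

Definition hypograph n (D : set 'cV[R]_n) (f : 'cV[R]_n -> R) : set 'cV[R]_(1 + n) :=
  [set z | D (dsubmx z) /\ 0 <= usubmx z 0 0 <= f (dsubmx z)].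

Lemma col_measurable_fun_comp n m (f : 'cV[R]_m -> R) (A : 'M[R]_(m, n)) :
  col_measurable_fun f -> col_measurable_fun (fun y => f (A *m y)).
Proof.
move=> mf _ Y mY; rewrite setTI.
apply: (@col_measurable_lin _ _ _ A (f @^-1` Y)).
by have := mf measurableT _ mY; rewrite setTI.
Qed.

Lemma col_measurable_hypograph n D (f : 'cV[R]_n -> R) :
  col_measurable D -> col_measurable_fun f -> col_measurable (hypograph D f).
Proof.
move=> mD mf.
have dE (z : 'cV[R]_(1 + n)) : dsubmx z = row_mx 0 1%:M *m z.
  by rewrite -{2}(vsubmxK z) mul_row_col mul0mx mul1mx add0r.
have uE (z : 'cV[R]_(1 + n)) : usubmx z 0 0 = z (lshift n 0) 0 by rewrite mxE.
rewrite (_ : hypograph D f = [set z : 'cV[R]_(1 + n) | D (row_mx 0 1%:M *m z)] `&`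
   ([set z : 'cV[R]_(1 + n) | 0 <= z (lshift n 0) 0] `&`
    [set z : 'cV[R]_(1 + n) | z (lshift n 0) 0 <= f (row_mx 0 1%:M *m z)])); last first.
  apply/seteqP; split=> z; rewrite /hypograph /= -dE -uE.
    by move=> [? /andP[]].
  by move=> [? [-> ->]].
apply: col_measurableI; first exact: col_measurable_lin.
have mu := @col_measurable_fun_coord R (1 + n)%N (lshift n 0).
apply: col_measurableI; apply: col_measurable_le => //.
  exact: col_measurable_fun_cst.
exact: col_measurable_fun_comp.
Qed.

Lemma Vol_hypograph n D (f : 'cV[R]_n -> R) :
  col_measurable D -> col_measurable_fun f -> (forall y, D y -> 0 <= f y) ->
  Vol (hypograph D f) = (\int[@lebesgue_tuple R n]_(t in @col_of_tuple R n @^-1` D)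
                           (f (col_of_tuple t))%:E)%E.
Proof.
move=> mD mf f0; rewrite Vol_fibers; last exact: col_measurable_hypograph.
rewrite [RHS]integral_mkcond; apply: eq_integral => t _.
rewrite patchE; set y := col_of_tuple t.
rewrite /hypograph; under eq_set do rewrite /= col_mxKu col_mxKd mxE eqxx.
have [yD|yD] := boolP (t \in _).
  move: yD; rewrite inE => /= Dy.
  rewrite (_ : [set x | _] = `[0, f y]%classic); last first.
    by apply/seteqP; split=> x; rewrite /= in_itv/= => // -[].
  rewrite lebesgue_measure_itv/= lte_fin sube0; case: ltP => // fy0.
  by congr (_%:E); apply/eqP; rewrite eq_le fy0 f0.
rewrite (_ : [set x | _] = set0) ?measure0//.
by apply/seteqP; split=> // x [Dy _]; move/negP: yD; apply; rewrite inE.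
Qed.

(** The barycentric coordinates of y in the standard simplex, with that of the
    vertex 0 first. *)
Definition bary n (y : 'cV[R]_n) : 'cV[R]_(1 + n) :=
  col_mx (1 - \sum_i y i 0)%:M y.

Lemma bary_lshift n (y : 'cV[R]_n) (i : 'I_1) :
  bary y (lshift n i) 0 = 1 - \sum_i y i 0.
Proof. by rewrite col_mxEu mxE !ord1. Qed.

Lemma bary_rshift n (y : 'cV[R]_n) i : bary y (rshift 1 i) 0 = y i 0.
Proof. by rewrite col_mxEd. Qed.

Lemma bary_ge0 n (y : 'cV[R]_n) : std_simplex y <-> forall j, 0 <= bary y j 0.
Proof.
split=> [[y0 y1] j|h].
  by case: (split_ordP j) => i ->; rewrite ?bary_lshift ?bary_rshift// subr_ge0.
split=> [i|]; first by have := h (rshift 1 i); rewrite bary_rshift.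
by have := h (lshift n 0); rewrite bary_lshift subr_ge0.
Qed.

Lemma col_measurable_fun_bary n (j : 'I_(1 + n)) :
  col_measurable_fun (fun y : 'cV[R]_n => bary y j 0).
Proof.
case: (split_ordP j) => i ->; last first.
  under eq_fun do rewrite bary_rshift.
  exact: col_measurable_fun_coord.
under eq_fun do rewrite bary_lshift.
apply: (@measurable_funB _ _ R setT (cst 1)
  (fun t : n.-tuple mR => \sum_i col_of_tuple t i 0)) => //.
by apply: (@col_measurable_fun_sum _ n _ _ (fun k y => y k 0)) => k;
  exact: col_measurable_fun_coord.
Qed.

(** For the vertex 0 the region 0 <= t <= 1 - sum y is itself the standard
    simplex. For another vertex i the shear y_i |-> y_i - t maps the region onto
    the standard simplex: t <= y_i becomes y_i >= 0, and sum y <= 1 becomes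
    t + sum y <= 1. *)
Lemma Vol_hypograph_bary n (j : 'I_(1 + n)) :
  Vol (hypograph (@std_simplex n) (fun y => bary y j 0)) =
  Vol (@std_simplex (1 + n)).
Proof.
have sum_split (z : 'cV[R]_(1 + n)) :
    \sum_i z i 0 = usubmx z 0 0 + \sum_i dsubmx z i 0.
  rewrite big_split_ord big_ord1 mxE; congr (_ + _).
  by apply: eq_bigr => i _; rewrite mxE.
have std_split (z : 'cV[R]_(1 + n)) : std_simplex z <->
    [/\ 0 <= usubmx z 0 0, forall i, 0 <= dsubmx z i 0 &
        usubmx z 0 0 + \sum_i dsubmx z i 0 <= 1].
  rewrite /std_simplex /= sum_split; split=> [[z0 z1]|[zu zd z1]]; split => //.
  - by rewrite mxE.
  - by move=> i; rewrite mxE.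
  - move=> i; case: (split_ordP i) => k ->; last by have := zd k; rewrite mxE.
    by have := zu; rewrite mxE ord1.
case: (split_ordP j) => i ->.
  congr Vol; apply/seteqP; split=> z; rewrite std_split /hypograph /= bary_lshift.
    by move=> [[zd z1] /andP[zu]]; split=> //; rewrite -lerBrDr.
  move=> [zu zd z1]; split; last by rewrite zu lerBrDr.
  by split => //; apply: le_trans z1; rewrite lerDr.
set B := block_mx 1%:M 0 (- delta_mx i 0) 1%:M : 'M[R]_(1 + n).
have -> : Vol (@std_simplex (1 + n)) = Vol [set z | std_simplex (B *m z)].
  rewrite Vol_scaling_lower_shear; last exact: col_measurable_std_simplex.
  by rewrite det_lblock !det1 mulr1 normr1 invr1 mul1e.
have uB z : usubmx (B *m z) 0 0 = usubmx z 0 0.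
  by rewrite -{1}(vsubmxK z) mul_block_col col_mxKu mul1mx mul0mx addr0.
have dB z k : dsubmx (B *m z) k 0 = dsubmx z k 0 - (k == i)%:R * usubmx z 0 0.
  rewrite -{1}(vsubmxK z) mul_block_col col_mxKd mul1mx mulNmx addrC !mxE.
  by rewrite big_ord1 !mxE ord1 eqxx andbT.
have sB z : \sum_k dsubmx (B *m z) k 0 = \sum_k dsubmx z k 0 - usubmx z 0 0.
  under eq_bigr do rewrite dB.
  rewrite sumrB; congr (_ - _); rewrite (bigD1 i)//= eqxx mul1r big1 ?addr0//.
  by move=> k /negPf ->; rewrite mul0r.
congr Vol; apply/seteqP; split=> z; rewrite /= std_split uB sB /hypograph /=
  bary_rshift addrC subrK.
  move=> [[zd z1] /andP[zu zi]]; split => // k; rewrite dB.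
  by have [->|_] := eqVneq k i; rewrite ?mul0r ?subr0 ?mul1r ?subr_ge0.
move=> [zu zd z1].
have zi : usubmx z 0 0 <= dsubmx z i 0.
  by have := zd i; rewrite dB eqxx mul1r subr_ge0.
split; last by rewrite zu.
split=> // k; have := zd k; rewrite dB; have [->|_] := eqVneq k i.
  by move=> _; exact: le_trans zi.
by rewrite mul0r subr0.
Qed.

(** An affine function is a combination of barycentric coordinates, and all of
    these have the same integral over the standard simplex. *)
Lemma Vol_prism n (h : 'I_(1 + n) -> R) : (forall j, 0 <= h j) ->
  Vol (hypograph (@std_simplex n) (fun y => \sum_j h j * bary y j 0)) =
  ((\sum_j h j)%:E * Vol (@std_simplex (1 + n)))%E.
Proof.
move=> h0; have mD := @col_measurable_std_simplex n.
have mbary j : measurable_fun setT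
    (fun t : n.-tuple mR => bary (col_of_tuple t) j 0 : mR).
  exact: col_measurable_fun_bary.
rewrite Vol_hypograph//; first last.
- by move=> y /bary_ge0 y0; apply: sumr_ge0 => j _; rewrite mulr_ge0.
- apply: col_measurable_fun_sum => j; apply: measurable_funM => //.
  exact: col_measurable_fun_bary.
under eq_integral do rewrite -sumEFin; rewrite ge0_integral_sum//; first last.
- by move=> j t /bary_ge0 y0; rewrite lee_fin mulr_ge0.
- move=> j; apply/measurable_EFinP/measurable_funM => //.
  by apply: measurable_funTS; exact: mbary.
rewrite -sumEFin ge0_sume_distrl; last by move=> j _; rewrite lee_fin.
apply: eq_bigr => j _; under eq_integral do rewrite EFinM.
rewrite ge0_integralZl_EFin//; first last.
- by apply/measurable_EFinP; apply: measurable_funTS; exact: mbary.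
- by move=> t /bary_ge0 y0; rewrite lee_fin.
rewrite -(Vol_hypograph_bary j) Vol_hypograph//.
- exact: col_measurable_fun_bary.
- by move=> y /bary_ge0.
Qed.

End StandardBodies.

(** * Inner product and convex hulls of finite families *)

Section DotProduct.
Context {R : realType} {n : nat}.
Implicit Types x y z : 'cV[R]_n.

Lemma dotE x y : dot x y = (x^T *m y) 0 0.
Proof. by rewrite mxE; apply: eq_bigr => i _; rewrite mxE. Qed.

Lemma dotC x y : dot x y = dot y x.
Proof. by apply: eq_bigr => i _; rewrite mulrC. Qed.

Lemma dotDr x y z : dot x (y + z) = dot x y + dot x z.
Proof. by rewrite !dotE mulmxDr mxE. Qed.

Lemma dotZr a x y : dot x (a *: y) = a * dot x y.
Proof. by rewrite !dotE -scalemxAr mxE. Qed.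

Lemma dotNr x y : dot x (- y) = - dot x y.
Proof. by rewrite !dotE mulmxN mxE. Qed.

Lemma dotDl x y z : dot (x + y) z = dot x z + dot y z.
Proof. by rewrite dotC dotDr !(dotC z). Qed.

Lemma dotZl a x y : dot (a *: x) y = a * dot x y.
Proof. by rewrite dotC dotZr dotC. Qed.

Lemma dotNl x y : dot (- x) y = - dot x y.
Proof. by rewrite dotC dotNr dotC. Qed.

Lemma dot0r x : dot x 0 = 0.
Proof. by rewrite dotE mulmx0 mxE. Qed.

Lemma dot_sumr (I : Type) (r : seq I) (F : I -> 'cV[R]_n) x :
  dot x (\sum_(i <- r) F i) = \sum_(i <- r) dot x (F i).
Proof. exact: (big_morph _ (dotDr x) (dot0r x)). Qed.

Lemma dot_ge0 x : 0 <= dot x x.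
Proof. by apply: sumr_ge0 => i _; rewrite -expr2 sqr_ge0. Qed.

Lemma dot_eq0 x : (dot x x == 0) = (x == 0).
Proof.
apply/eqP/eqP => [|->]; last exact: dot0r.
move=> /eqP; rewrite psumr_eq0; last by move=> i _; rewrite -expr2 sqr_ge0.
move=> /allP h; apply/colP => i; rewrite mxE.
by have := h i (mem_index_enum _); rewrite /= -expr2 sqrf_eq0 => /eqP.
Qed.

Lemma enorm_sqr x : enorm x ^+ 2 = dot x x.
Proof. by rewrite sqr_sqrtr ?dot_ge0. Qed.

Lemma enorm_gt0 x : (0 < enorm x) = (x != 0).
Proof. by rewrite sqrtr_gt0 lt_def dot_ge0 dot_eq0 andbT. Qed.

End DotProduct.

Section Convexity.
Context {R : realType} {n : nat}.
Implicit Types (A B : set 'cV[R]_n) (x y : 'cV[R]_n).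

Lemma convex_setP A : convex_set A <->
  forall x y (t : R), 0 <= t -> t <= 1 -> A x -> A y -> A (t *: x + (1 - t) *: y).
Proof.
split=> [cA x y t t0 t1 Ax Ay|cA x y t].
  by have := cA x y (Itv01 t0 t1) (mem_set Ax) (mem_set Ay); rewrite inE.
by rewrite !inE => Ax Ay; apply: cA.
Qed.

Lemma convex_set_hull A : convex_set (convex_hull A).
Proof.
apply/convex_setP => x y t t0 t1 hx hy B [cB AB].
by apply: (convex_setP B).1 => //; [exact: hx|exact: hy].
Qed.

(** Induction on the number of points, with the partial sums renormalised; a
    partial sum of weights can be zero, in which case its points do not count. *)
Lemma convex_set_sum (I : finType) (A : set 'cV[R]_n) (a : I -> R) (p : I -> 'cV[R]_n) :
  convex_set A -> (forall i, 0 <= a i) -> \sum_i a i = 1 ->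
  (forall i, a i != 0 -> A (p i)) -> A (\sum_i a i *: p i).
Proof.
move=> /convex_setP cA a0 a1 Ap.
suff H (r : seq I) : 0 < \sum_(i <- r) a i ->
    A ((\sum_(i <- r) a i)^-1 *: \sum_(i <- r) a i *: p i).
  by have := H (index_enum I); rewrite a1 invr1 scale1r; exact.
elim: r => [|i r IHr]; first by rewrite big_nil ltxx.
rewrite !big_cons; set s := \sum_(j <- r) a j; set q := \sum_(j <- r) _.
have s0 : 0 <= s by exact: sumr_ge0.
have [s00|sn0] := eqVneq s 0.
  rewrite s00 addr0 => ai; rewrite (_ : q = 0).
    by rewrite addr0 scalerA mulVf ?gt_eqF// scale1r; apply: Ap; rewrite gt_eqF.
  move/eqP: s00; rewrite psumr_eq0// => /allP h.
  by apply: big1_seq => j /andP[_ /h /eqP ->]; rewrite scale0r.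
have {}s0 : 0 < s by rewrite lt_def sn0.
have [-> _|ai] := eqVneq (a i) 0; first by rewrite add0r scale0r add0r; exact: IHr.
move=> t0; have tn0 : a i + s != 0 by rewrite gt_eqF.
have -> : (a i + s)^-1 *: (a i *: p i + q) =
    (a i / (a i + s)) *: p i + (1 - a i / (a i + s)) *: (s^-1 *: q).
  rewrite scalerDr !scalerA; congr (_ *: _ + _ *: _); first by rewrite mulrC.
  by field; rewrite sn0.
apply: cA; [by rewrite divr_ge0// ltW| |exact: Ap|exact: IHr].
by rewrite ler_pdivrMr// mul1r lerDl ltW.
Qed.

(** The combinations supported by P form a convex set, and every convex set
    containing the points of P contains them. *)
Lemma convex_hull_finite k (s : 'I_k -> 'cV[R]_n) (P : set 'I_k) :
  convex_hull (s @` P) = [set x | exists a : 'I_k -> R,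
    [/\ forall i, 0 <= a i, \sum_i a i = 1, forall i, ~ P i -> a i = 0 &
        x = \sum_i a i *: s i]].
Proof.
apply/seteqP; split.
  apply: smallest_sub.
    apply/convex_setP => _ _ t t0 t1 [a [a0 a1 aP ->]] [b [b0 b1 bP ->]].
    exists (fun i => t * a i + (1 - t) * b i); split.
    - by move=> i; rewrite addr_ge0// mulr_ge0// subr_ge0.
    - by rewrite big_split/= -!mulr_sumr a1 b1 !mulr1 addrC subrK.
    - by move=> i Pi; rewrite aP// bP// !mulr0 addr0.
    - rewrite !scaler_sumr -big_split; apply: eq_bigr => i _ /=.
      by rewrite [RHS]scalerDl !scalerA.
  move=> _ [j Pj <-]; exists (fun i => (i == j)%:R); split.
  - by move=> i; rewrite ler0n.
  - by rewrite (bigD1 j)//= eqxx big1 ?addr0// => i /negPf ->.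
  - by move=> i Pi; have [ij|] := eqVneq i j => //; move: Pi; rewrite ij.
  - rewrite (bigD1 j)//= eqxx scale1r big1 ?addr0// => i /negPf ->.
    by rewrite scale0r.
move=> x [a [a0 a1 aP ->]]; apply: convex_set_sum => //.
  exact: convex_set_hull.
move=> i ai; apply: sub_gen_smallest; exists i => //.
by apply: contrapT => nPi; rewrite (aP _ nPi) eqxx in ai.
Qed.

End Convexity.

(** * Simplices with a vertex at the origin *)

Section SimplexAtOrigin.
Context {R : realType} {n : nat}.
Context (v : 'I_n.+1 -> 'cV[R]_n).

Definition vertex_mx : 'M[R]_n := \matrix_(i, j) v (lift ord0 j) i 0.
Local Notation M := vertex_mx.

Lemma vertex_mx_mul c : M *m c = \sum_j c j 0 *: v (lift ord0 j).
Proof.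
apply/colP => i; rewrite mxE summxE; apply: eq_bigr => j _.
by rewrite !mxE mulrC.
Qed.

Lemma vertex_mx_const1 : M *m const_mx 1 = \sum_j v (lift ord0 j).
Proof. by rewrite vertex_mx_mul; apply: eq_bigr => j _; rewrite mxE scale1r. Qed.

Lemma bary_ord0 (c : 'cV[R]_n) : bary c ord0 0 = 1 - \sum_i c i 0.
Proof. by rewrite -(bary_lshift c ord0); congr (bary c _ 0); exact/val_inj. Qed.

Lemma bary_lift (c : 'cV[R]_n) j : bary c (lift ord0 j) 0 = c j 0.
Proof. by rewrite -(bary_rshift c j); congr (bary c _ 0); exact/val_inj. Qed.

Lemma sum_bary (c : 'cV[R]_n) : \sum_(i < n.+1) bary c i 0 = 1.
Proof.
rewrite big_ord_recl bary_ord0.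
by under [X in _ + X]eq_bigr do rewrite bary_lift; rewrite subrK.
Qed.

Hypothesis v0 : v ord0 = 0.

Lemma sum_bary_vertex (c : 'cV[R]_n) : \sum_(i < n.+1) bary c i 0 *: v i = M *m c.
Proof.
rewrite big_ord_recl v0 scaler0 add0r vertex_mx_mul.
by apply: eq_bigr => j _; rewrite bary_lift.
Qed.

Lemma baryE (a : 'I_n.+1 -> R) :
  \sum_i a i = 1 -> a =1 fun i => bary (\col_j a (lift ord0 j)) i 0.
Proof.
move=> a1 i; case: (unliftP ord0 i) => [j ->|->].
  by rewrite bary_lift mxE.
rewrite bary_ord0 -a1 big_ord_recl; under [X in _ - X]eq_bigr do rewrite mxE.
by rewrite addrK.
Qed.

Lemma convex_hull_verticesE (P : set 'I_n.+1) :
  convex_hull (v @` P) =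
  [set M *m c | c in [set c | std_simplex c /\ forall i, ~ P i -> bary c i 0 = 0]].
Proof.
rewrite convex_hull_finite; apply/seteqP; split.
  move=> x [a [a0 a1 aP ->]]; have aE := baryE a1.
  exists (\col_j a (lift ord0 j)).
    by split=> [|i Pi]; [apply/bary_ge0 => i|]; rewrite -aE// aP.
  by rewrite -sum_bary_vertex; apply: eq_bigr => i _; rewrite [in RHS]aE.
move=> x [c [/bary_ge0 c0 cP] <-]; exists (fun i => bary c i 0); split => //.
  exact: sum_bary.
by rewrite sum_bary_vertex.
Qed.

Lemma simplexE : simplex v = [set M *m c | c in @std_simplex R n].
Proof.
rewrite /simplex convex_hull_verticesE; congr image.
by apply/seteqP; split=> c; [case|move=> cS; split => // i /(_ I)].
Qed.

Lemma facetE i : facet v i =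
  [set M *m c | c in [set c | std_simplex c /\ bary c i 0 = 0]].
Proof.
rewrite /facet convex_hull_verticesE; congr image.
apply/seteqP; split=> c [cS ci]; split => //.
  by apply: ci => /=; rewrite eqxx.
by move=> j /negP; rewrite negbK => /eqP ->.
Qed.

Hypothesis v_indep : affinely_independent v.

(** A linear relation between the vertices other than 0 becomes an affine
    relation when the vertex 0 receives the opposite of the sum of the
    coefficients. *)
Lemma det_vertex_mx : \det M != 0.
Proof.
apply/negP; rewrite -det_tr => /det0P[w w0 wM].
have Mw : M *m w^T = 0 by rewrite -[M]trmxK -trmx_mul wM trmx0.
pose c (i : 'I_n.+1) := if unlift ord0 i is Some j then w 0 j else - \sum_j w 0 j.
have cl j : c (lift ord0 j) = w 0 j by rewrite /c liftK.
move/negP: w0; apply; apply/eqP/rowP => j; rewrite mxE -cl.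
apply: v_indep; rewrite big_ord_recl.
  by under eq_bigr do rewrite cl; rewrite /c unlift_none addNr.
rewrite v0 scaler0 add0r -[RHS]Mw vertex_mx_mul.
by apply: eq_bigr => k _; rewrite cl mxE.
Qed.

Let uM : M \in unitmx. Proof. by rewrite unitmxE unitfE det_vertex_mx. Qed.

Lemma continuous_mulmx_coord (A : 'M[R]_n) i :
  continuous (fun y : 'cV[R]_n => (A *m y) i 0).
Proof.
move=> x; have -> : (fun y : 'cV[R]_n => (A *m y) i 0) =
    fun y => \sum_j A i j * y j 0 by apply/funext => y; rewrite mxE.
suff H r : (fun y : 'cV[R]_n => \sum_(j <- r) A i j * y j 0) @ x -->
    \sum_(j <- r) A i j * x j 0.
  exact: H.
elim: r => [|j r IHr].
  rewrite big_nil (_ : (fun y : 'cV[R]_n => _) = cst 0); first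
    exact: (@cvg_cst _ _ _ _ (nbhs_filter x)).
  by apply/funext => y; rewrite big_nil.
rewrite big_cons (_ : (fun y : 'cV[R]_n => _) = (fun y : 'cV[R]_n => A i j * y j 0) \+
  (fun y : 'cV[R]_n => \sum_(k <- r) A i k * y k 0)); last first.
  by apply/funext => y; rewrite big_cons.
apply: (@cvgD _ _ _ _ (nbhs_filter x)); last exact: IHr.
apply: (@cvgM _ _ _ (nbhs_filter x)); last exact: coord_continuous.
exact: (@cvg_cst _ _ _ _ (nbhs_filter x)).
Qed.

(** The line leaving the facet upwards makes the i-th coordinate negative at
    once. Any point whose other barycentric coordinates are positive is in the
    relative interior, since these coordinates stay positive nearby while the
    i-th one vanishes on the affine hull of the facet. *)
Lemma upper_facet_lift u i : (invmx M *m u) i 0 < 0 ->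
  upper_facet (simplex v) u (facet v (lift ord0 i)).
Proof.
(* Weight 1 / (n + 1) at the nonzero vertices of the facet leaves a positive
   weight for the vertex 0. *)
move=> ui; pose a : R := n.+1%:R^-1.
have a0 : 0 < a by rewrite invr_gt0.
pose c : 'cV[R]_n := \col_j (if j == i then 0 else a).
have ci : c i 0 = 0 by rewrite mxE eqxx.
have c_gt0 j : j != i -> 0 < c j 0 by rewrite mxE => /negPf ->.
have c0 j : 0 <= c j 0 by rewrite mxE; case: ifP => // _; exact: ltW.
have c1 : \sum_j c j 0 < 1.
  apply: (@le_lt_trans _ _ (\sum_(j < n) a)).
    by apply: ler_sum => j _; rewrite mxE; case: ifP => // _; exact: ltW.
  by rewrite sumr_const card_ord -mulr_natl ltr_pdivrMr// mul1r ltr_nat.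
have cS : std_simplex c by split => //; exact: ltW.
pose x : 'cV[R]_n := M *m c; have xE : invmx M *m x = c by rewrite mulKmx.
pose near_x := nbhs_filter x.
exists x; split.
- split; first by rewrite facetE; exists c => //; split => //; rewrite bary_lift.
  have near_ge0 j : \forall y \near x, j != i -> 0 < (invmx M *m y) j 0.
    have [->|ji] := eqVneq j i; first exact: (@nearW _ _ _ near_x).
    have cj : (fun y : 'cV[R]_n => (invmx M *m y) j 0) @ x --> c j 0.
      by rewrite -xE; exact: continuous_mulmx_coord.
    have := @cvgr_gt _ _ _ near_x _ _ cj _ (c_gt0 _ ji); apply: filterS => y //.
  have near_lt1 : \forall y \near x, \sum_j (invmx M *m y) j 0 < 1.
    (* The sum of the coordinates is itself a coordinate of a linear map, so
       its continuity is another instance of the same lemma. *)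
    have sumE (y : 'cV[R]_n) : \sum_j (invmx M *m y) j 0 =
        ((const_mx 1 *m invmx M : 'M[R]_n) *m y) i 0.
      rewrite -mulmxA [in RHS]mxE.
      by apply: eq_bigr => j _; rewrite [in RHS]mxE mul1r.
    have cj : (fun y : 'cV[R]_n => \sum_j (invmx M *m y) j 0) @ x -->
        \sum_j c j 0.
      under eq_fun do rewrite sumE.
      rewrite -xE sumE; exact: continuous_mulmx_coord.
    exact: (@cvgr_lt _ _ _ near_x _ _ cj _ c1).
  have hull : affine_hull (facet v (lift ord0 i)) `<=` [set y | (invmx M *m y) i 0 = 0].
    apply: smallest_sub.
      move=> y z t /= xi zi.
      by rewrite mulmxDr -!scalemxAr mxE [X in X + _]mxE
        [X in _ + X]mxE xi zi !mulr0 addr0.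
    rewrite facetE => _ [d [_ di] <-] /=.
    by rewrite mulKmx// -bary_lift.
  have := @filter_forall _ _ _ _ near_x near_ge0 => /filterI/(_ near_lt1); apply: filterS.
  move=> y [y0 y1] /hull yi; rewrite facetE.
  exists (invmx M *m y); last by rewrite mulKVmx.
  split; last by rewrite bary_lift.
  split; last exact: ltW.
  by move=> j; have [->|/y0/ltW//] := eqVneq j i; rewrite yi.
- by rewrite simplexE; exists c.
- move=> t t0; rewrite simplexE => -[d [d0 _]] /(congr1 (mulmx (invmx M))).
  rewrite mulKmx// mulmxDr mulKmx// -scalemxAr => dE.
  have := d0 i; rewrite dE mxE ci add0r mxE leNgt => /negP; apply.
  by rewrite pmulr_rlt0.
Qed.

(** The constant b is the distance from the origin to the hyperplane of F_0; it
    is not zero because the origin belongs to S but not to F_0. *)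
Lemma outward_normal_vertices u0 :
  outward_unit_normal (simplex v) (facet v ord0) u0 ->
  exists2 b, 0 < b & forall j, dot u0 (v (lift ord0 j)) = b.
Proof.
move=> [_ [b [Sb FE]]]; exists b; last first.
  move=> j; have : facet v ord0 (v (lift ord0 j)).
    by apply: sub_gen_smallest; exists (lift ord0 j).
  by rewrite FE => -[].
have S0 : simplex v 0 by apply: sub_gen_smallest; exists ord0.
have b0 : 0 <= b by rewrite -(dot0r u0); exact: Sb.
rewrite lt_def b0 andbT; apply/eqP => b00.
have : facet v ord0 0 by rewrite FE; split => //=; rewrite dot0r.
rewrite facetE => -[c [_ c0]] /(congr1 (mulmx (invmx M))).
rewrite mulKmx// mulmx0 => cE; move/eqP: c0.
by rewrite bary_ord0 cE big1 ?subr0 ?oner_eq0// => j _; rewrite mxE.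
Qed.

End SimplexAtOrigin.

(** * The hull of a simplex and of its mirror image *)

Section DoubledPrism.
Context {R : realType} {n : nat} (v : 'I_n.+1 -> 'cV[R]_n) (u : 'cV[R]_n).
Local Notation M := (vertex_mx v).
Local Notation S := (simplex v).

(** The vertical segments that join the points M c of the facet opposite to 0
    to their mirror images; t is the depth below that facet. *)
Definition doubled_prism : set 'cV[R]_n :=
  [set x | exists (c : 'cV[R]_n) (t : R),
    [/\ forall j, 0 <= c j 0, \sum_j c j 0 = 1,
        0 <= t <= 2 * dot u (M *m c) & x = M *m c - t *: u]].

Lemma convex_doubled_prism : convex_set doubled_prism.
Proof.
apply/convex_setP => _ _ a a0 a1 [c [t [c0 c1 /andP[t0 t1] ->]]]
  [d [r [d0 d1 /andP[r0 r1] ->]]].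
have a1' : 0 <= 1 - a by rewrite subr_ge0.
exists (a *: c + (1 - a) *: d), (a * t + (1 - a) * r); split.
- by move=> j; rewrite !mxE addr_ge0// mulr_ge0.
- under eq_bigr do rewrite !mxE.
  by rewrite big_split/= -!mulr_sumr c1 d1; ring.
- rewrite addr_ge0 ?mulr_ge0//= mulmxDr -!scalemxAr dotDr !dotZr.
  have := ler_wpM2l a0 t1; have := ler_wpM2l a1' r1; lra.
- rewrite mulmxDr -!scalemxAr; apply/colP => i; rewrite !mxE; ring.
Qed.

Hypotheses (v0 : v ord0 = 0) (v_indep : affinely_independent v).
Hypothesis u_unit : enorm u = 1.
Hypothesis v_above : forall j, 0 < dot u (v (lift ord0 j)).
Hypothesis u_coord : forall i, 0 <= (invmx M *m u) i 0.

Let dot_u : dot u u = 1. Proof. by rewrite -enorm_sqr u_unit expr1n. Qed.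

Let uM : M \in unitmx.
Proof. by rewrite unitmxE unitfE det_vertex_mx. Qed.

Lemma dot_vertex_mx x c : dot x (M *m c) = \sum_j dot x (v (lift ord0 j)) * c j 0.
Proof.
rewrite vertex_mx_mul dot_sumr; apply: eq_bigr => j _.
by rewrite dotZr mulrC.
Qed.

(** The coordinates of u are nonnegative and, u being a unit vector, not all
    zero. The inverse of their sum is the height at which the vertical ray from
    the origin leaves the simplex. *)
Lemma sum_coord_gt0 : 0 < \sum_i (invmx M *m u) i 0.
Proof.
rewrite lt_def sumr_ge0// andbT; apply/negP; rewrite psumr_eq0// => /allP h.
have u0 : invmx M *m u = 0.
  by apply/colP => i; rewrite [RHS]mxE; apply/eqP/h/mem_index_enum.
have : dot u u = 0 by rewrite -{2}(mulKVmx uM u) u0 mulmx0 dot0r.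
by rewrite dot_u => /eqP; rewrite oner_eq0.
Qed.

Lemma reflection_doubled_prism x :
  doubled_prism x -> doubled_prism (reflection u x).
Proof.
move=> [c [t [c0 c1 /andP[t0 t1] ->]]]; exists c, (2 * dot u (M *m c) - t); split => //.
  by rewrite subr_ge0 t1 lerBlDr lerDl.
rewrite /reflection dotDr dotNr dotZr dot_u mulr1; apply/colP => i; rewrite !mxE.
ring.
Qed.

(** The vertex 0 lies in the prism because it is the midpoint of the vertical
    segment through u / L, the point where the vertical ray from 0 meets the
    facet, L being the sum of the coordinates of u. Conversely, a vertical
    segment joins two points of the union. *)
Lemma convex_hull_reflection :
  convex_hull (S `|` reflection u @` S) = doubled_prism.
Proof.
set L := \sum_i (invmx M *m u) i 0; have L0 : 0 < L := sum_coord_gt0.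
have dot_Mc (c : 'cV[R]_n) : (forall j, 0 <= c j 0) -> 0 <= dot u (M *m c).
  by move=> c0; rewrite dot_vertex_mx sumr_ge0// => j _; rewrite mulr_ge0// ltW.
have SK : S `<=` doubled_prism.
  apply: smallest_sub; first exact: convex_doubled_prism.
  move=> _ [i _ <-]; case: (unliftP ord0 i) => [j ->|->].
    exists (delta_mx j 0), 0; split.
    - by move=> k; rewrite mxE ler0n.
    - rewrite (bigD1 j)//= mxE !eqxx big1 ?addr0// => k /negPf kj.
      by rewrite mxE kj.
    - rewrite lexx/= mulr_ge0// dot_Mc// => k; rewrite mxE; exact: ler0n.
    - rewrite scale0r subr0 -colE; apply/colP => k; by rewrite !mxE.
  exists (L^-1 *: (invmx M *m u)), L^-1.
  have ME : M *m (L^-1 *: (invmx M *m u)) = L^-1 *: u.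
    by rewrite -scalemxAr mulKVmx.
  have L1 : 0 <= L^-1 by rewrite invr_ge0 ltW.
  split.
  - by move=> j; rewrite mxE mulr_ge0.
  - under eq_bigr do rewrite mxE.
    by rewrite -mulr_sumr mulVf// gt_eqF.
  - by rewrite ME dotZr dot_u; lra.
  - by rewrite ME subrr v0.
apply/seteqP; split.
  apply: smallest_sub; first exact: convex_doubled_prism.
  move=> x [|[y Sy <-]]; first exact: SK.
  exact/reflection_doubled_prism/SK.
move=> x [c [t [c0 c1 /andP[t0 t1] ->]]].
have Sc : S (M *m c).
  by rewrite simplexE//; exists c => //; split => //; rewrite c1.
have k0 := dot_Mc _ c0; set k := dot u (M *m c) in k0 t1.
have hc : convex_hull (S `|` reflection u @` S) (M *m c).
  by apply: sub_gen_smallest; left.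
(* The point has parameter t / (2 k) on the segment from M c to its mirror
   image; for k = 0 the segment is a single point. *)
have [k00|kn0] := eqVneq k 0.
  have -> : t = 0 by apply/eqP; rewrite eq_le t0 (le_trans t1)// k00 mulr0.
  by rewrite scale0r subr0.
have {}k0 : 0 < k by rewrite lt_def kn0.
have -> : M *m c - t *: u =
    (t / (2 * k)) *: reflection u (M *m c) + (1 - t / (2 * k)) *: (M *m c).
  apply/colP => i; rewrite /reflection -/k !mxE; field.
  by rewrite kn0.
have /convex_setP cH := @convex_set_hull R n (S `|` reflection u @` S).
apply: cH => //.
- by rewrite divr_ge0// mulr_ge0// ltW.
- by rewrite ler_pdivrMr ?mul1r// mulr_gt0.
- by apply: sub_gen_smallest; right; exists (M *m c).
Qed.

End DoubledPrism.

Section DoubledPrismVolume.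
Context {R : realType} {m : nat}.
Local Notation n := (1 + m)%N.
Context (v : 'I_n.+1 -> 'cV[R]_n) (u : 'cV[R]_n).
Local Notation M := (vertex_mx v).
Local Notation e0 := (delta_mx (ord0 : 'I_m.+1) 0 : 'cV[R]_n).

Lemma bary_affine (y : 'cV[R]_m) :
  bary y = col_mx (- const_mx 1) 1%:M *m y + e0.
Proof.
rewrite mul_col_mx mul1mx; apply/colP => i.
case: (split_ordP i) => k ->.
  rewrite bary_lshift mxE col_mxEu !mxE !ord1 eqxx addrC.
  by congr (_ + _); rewrite -sumrN; apply: eq_bigr => j _; rewrite !mxE mulN1r.
by rewrite bary_rshift mxE col_mxEd mxE addr0.
Qed.

(** Linear part of the map (t, y) |-> M (bary y) - t u, whose constant part is
    the image under M of the first basis vector. *)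
Definition prism_mx : 'M[R]_n := row_mx (- u) (M *m col_mx (- const_mx 1) 1%:M).

Lemma prism_mxE (t : R) (y : 'cV[R]_m) :
  prism_mx *m col_mx t%:M y + M *m e0 = M *m bary y - t *: u.
Proof.
rewrite mul_row_col mul_mx_scalar scalerN bary_affine mulmxDr mulmxA.
by rewrite -addrA addrC.
Qed.

(** In the basis M the first column is minus the coordinates of u, and the
    others are differences e_j - e_0; adding all rows to the first one leaves a
    triangular matrix whose corner is minus the sum of these coordinates. *)
Lemma det_prism_mx : M \in unitmx ->
  \det prism_mx = - (\det M * \sum_i (invmx M *m u) i 0).
Proof.
move=> uM; pose w := invmx M *m u.
have -> : prism_mx = M *m block_mx (- usubmx w) (- const_mx 1) (- dsubmx w) 1%:M.
  rewrite /prism_mx -{1}(mulKVmx uM u) -mulmxN -mul_mx_row; congr (_ *m _).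
  by rewrite /block_mx -{1}(vsubmxK (- _)) !linearN/= -block_mxEh.
rewrite det_mulmx -mulrN -/w; congr (_ * _); clearbody w.
pose U : 'M[R]_n := block_mx 1%:M (const_mx 1) 0 1%:M.
have <- : \det (U *m block_mx (- usubmx w) (- const_mx 1) (- dsubmx w) 1%:M) =
    \det (block_mx (- usubmx w) (- const_mx 1) (- dsubmx w) 1%:M : 'M[R]_n).
  by rewrite det_mulmx det_ublock !det1 !mul1r.
rewrite mulmx_block !mul1mx mul0mx mulmx1 addNr det_lblock mul0mx add0r det1 mulr1.
rewrite [X in \det X]mx11_scalar det_scalar1 !mxE big_split_ord big_ord1 opprD.
congr (_ + _); rewrite -sumrN; apply: eq_bigr => i _.
by rewrite !mxE mul1r.
Qed.

Lemma doubled_prismE : doubled_prism v u =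
  [set prism_mx *m z + M *m e0 | z in
    hypograph (@std_simplex R m)
      (fun y => \sum_j 2 * dot u (v (lift ord0 j)) * bary y j 0)].
Proof.
have hE (y : 'cV[R]_m) : \sum_j 2 * dot u (v (lift ord0 j)) * bary y j 0 =
    2 * dot u (M *m bary y).
  by rewrite dot_vertex_mx mulr_sumr; apply: eq_bigr => j _; rewrite mulrA.
apply/seteqP; split.
  move=> x [c [t [c0 c1 tc ->]]].
  have cE : c = bary (dsubmx c).
    apply/colP => i; case: (split_ordP i) => k ->.
      rewrite bary_lshift -c1 big_split_ord big_ord1 ord1.
      by under [X in _ - X]eq_bigr do rewrite mxE; rewrite addrK.
    by rewrite bary_rshift mxE.
  exists (col_mx t%:M (dsubmx c)); last by rewrite prism_mxE -cE.
  rewrite /hypograph /= col_mxKd col_mxKu mxE eqxx mulr1n hE -cE; split => //.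
  by apply/bary_ge0 => j; rewrite -cE.
move=> _ [z [zS zt] <-]; exists (bary (dsubmx z)), (usubmx z 0 0); split.
- by move/bary_ge0: zS.
- exact: sum_bary.
- by rewrite -hE.
- by rewrite -prism_mxE -mx11_scalar vsubmxK.
Qed.

Hypotheses (v0 : v ord0 = 0) (v_indep : affinely_independent v).
Hypothesis u_unit : enorm u = 1.
Hypothesis v_above : forall j, 0 < dot u (v (lift ord0 j)).
Hypothesis u_coord : forall i, 0 <= (invmx M *m u) i 0.

(** Both bodies are affine images of bodies whose volume is a multiple of that
    of the standard simplex. In the quotient the determinant of M and the volume
    of the standard simplex cancel. *)
Lemma Vol_hull_ratio :
  ((Vol (simplex v))^-1 *
    Vol (convex_hull (simplex v `|` reflection u @` simplex v)))%E =
  (2 * (\sum_i (invmx M *m u) i 0) * dot u (\sum_j v (lift ord0 j)))%:E.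
Proof.
have dM := det_vertex_mx v0 v_indep.
have uM : M \in unitmx by rewrite unitmxE unitfE.
have L0 := sum_coord_gt0 v0 v_indep u_unit u_coord.
rewrite convex_hull_reflection// doubled_prismE.
rewrite Vol_affine_image; last 2 first.
- by rewrite det_prism_mx// oppr_eq0 mulf_neq0// gt_eqF.
- apply: col_measurable_hypograph; first exact: col_measurable_std_simplex.
  apply: col_measurable_fun_sum => j; apply: measurable_funM => //.
  exact: col_measurable_fun_bary.
rewrite Vol_prism; last by move=> j; rewrite mulr_ge0// ltW.
have -> : simplex v = [set M *m c + 0 | c in @std_simplex R n].
  by rewrite simplexE//; apply: eq_imagel => c _; rewrite addr0.
rewrite Vol_affine_image//; last exact: col_measurable_std_simplex.
have := @Vol_std_simplex_gt0 R n; have := @Vol_std_simplex_lty R n.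
case: (Vol _) => [d| |]//= _; rewrite lte_fin => d0.
rewrite det_prism_mx// normrN normrM (gtr0_norm L0) dot_sumr.
have dM0 : `|\det M| != 0 by rewrite normr_eq0.
rewrite -mulr_sumr -!EFinM inver mulf_eq0 (negPf dM0) (gt_eqF d0)/= -EFinM.
by congr (_%:E); field; rewrite dM0 gt_eqF.
Qed.

End DoubledPrismVolume.

(** * The optimal direction *)

Section Bisector.
Context {R : realType} {n : nat} (u u0 s : 'cV[R]_n).
Hypotheses (u_unit : enorm u = 1) (u0_unit : enorm u0 = 1) (us_gt0 : 0 < dot u s).

Let dot_u : dot u u = 1. Proof. by rewrite -enorm_sqr u_unit expr1n. Qed.
Let dot_u0 : dot u0 u0 = 1. Proof. by rewrite -enorm_sqr u0_unit expr1n. Qed.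

Let sigma := enorm s.

Let sigma_gt0 : 0 < sigma.
Proof.
by rewrite enorm_gt0; apply: contraTneq us_gt0 => ->; rewrite dot0r ltxx.
Qed.

(** With r = 2 <u, s> u - s, the vector on the left is sigma u0 - r, and r has
    norm sigma; the right-hand side is therefore nonnegative, and zero only for
    r = sigma u0. *)
Let gap : dot (sigma *: u0 + s - (2 * dot u s) *: u)
              (sigma *: u0 + s - (2 * dot u s) *: u) =
  2 * sigma * (dot u0 s + sigma - 2 * dot u0 u * dot u s).
Proof.
have sE : dot s s = sigma ^+ 2 by rewrite enorm_sqr.
rewrite !(dotDl, dotDr, dotNl, dotNr, dotZl, dotZr) dot_u dot_u0 sE.
rewrite (dotC s u0) (dotC s u) (dotC u u0); ring.
Qed.

Lemma bisector_bound : 2 * dot u0 u * dot u s <= dot u0 s + sigma.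
Proof.
rewrite -subr_ge0 -(@pmulr_rge0 _ (2 * sigma)) ?mulr_gt0//.
by rewrite -gap dot_ge0.
Qed.

Lemma bisector_bound_eq :
  2 * dot u0 u * dot u s = dot u0 s + sigma <->
  sigma *: u0 + s = (2 * dot u s) *: u.
Proof.
split=> [e|e].
  apply/eqP; rewrite -subr_eq0 -dot_eq0 gap e subrr mulr0//.
have /eqP := gap; rewrite e subrr dot0r eq_sym mulf_eq0 gt_eqF ?mulr_gt0//=.
by rewrite subr_eq0 => /eqP.
Qed.

(** The vector sigma u0 + s is sigma times p, and p spans the bisector of u0
    and s; its norm is determined by |p|^2 = 2 <p, s> / sigma, which holds since
    p is a sum of two unit vectors. *)
Lemma bisector_direction (p := u0 + sigma^-1 *: s) :
  sigma *: u0 + s = (2 * dot u s) *: u <-> u = (enorm p)^-1 *: p.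
Proof.
have pE : sigma *: p = sigma *: u0 + s.
  by rewrite scalerDr scalerA divff ?gt_eqF// scale1r.
have sig0 : sigma != 0 by rewrite gt_eqF.
split=> [e|uE].
  pose k := 2 * dot u s / sigma.
  have k0 : 0 < k by rewrite divr_gt0// mulr_gt0.
  have pk : p = k *: u.
    apply: (scalerI sig0); rewrite pE e scalerA; congr (_ *: _).
    by rewrite /k; field.
  have -> : enorm p = k.
    by rewrite pk /enorm dotZl dotZr dot_u mulr1 -expr2 sqrtr_sqr gtr0_norm.
  by rewrite pk scalerA mulVf ?scale1r// gt_eqF.
have sE : dot s s = sigma ^+ 2 by rewrite enorm_sqr.
have p0 : enorm p != 0.
  apply/eqP => p0; move: dot_u; rewrite uE p0 invr0 scale0r dot0r => /eqP.
  by rewrite eq_sym oner_eq0.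
have pp : enorm p ^+ 2 = 2 * dot p s / sigma.
  rewrite enorm_sqr /p !(dotDl, dotDr, dotZl, dotZr) dot_u0 sE (dotC s u0).
  by field.
rewrite -pE uE dotZl scalerA; congr (_ *: _).
have -> : dot p s = enorm p ^+ 2 * sigma / 2 by rewrite pp; field.
by field.
Qed.

End Bisector.

Section Gram.
Context {R : realType} {n : nat} (M : 'M[R]_n) (u0 : 'cV[R]_n) (b : R).
Hypotheses (uM : M \in unitmx) (u0_unit : enorm u0 = 1) (b_gt0 : 0 < b).
Hypothesis M_u0 : u0^T *m M = b *: const_mx 1.

(** The hypothesis says that b (1, ..., 1) = u0^T M; substituting this on both
    sides of G^-1 leaves u0^T M G^-1 M^T u0 = |u0|^2 = 1. *)
Lemma sum_inv_gram :
  \sum_j (const_mx 1 *m invmx (M^T *m M) : 'rV[R]_n) 0 j = b^-1 ^+ 2.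
Proof.
have uMT : M^T \in unitmx by rewrite unitmx_tr.
have one_row : const_mx 1 = b^-1 *: (u0^T *m M) :> 'rV[R]_n.
  by rewrite M_u0 scalerA mulVf ?scale1r// gt_eqF.
have one_col : const_mx 1 = b^-1 *: (M^T *m u0) :> 'cV[R]_n.
  by rewrite -[LHS]trmxK trmx_const one_row linearZ/= trmx_mul trmxK.
transitivity ((const_mx 1 *m invmx (M^T *m M) *m const_mx 1 : 'M[R]_1) 0 0).
  by rewrite mxE; apply: eq_bigr => j _; rewrite [X in _ * X]mxE mulr1.
rewrite {1}one_row one_col -!scalemxAl -scalemxAr.
have uG : M^T *m M \in unitmx by rewrite unitmx_mul uMT.
have GE : M *m invmx (M^T *m M) *m M^T = 1%:M.
  have -> : invmx (M^T *m M) = invmx M *m invmx M^T.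
    rewrite -[LHS]mulmx1; apply/esym/(canRL (mulKmx uG)).
    rewrite mulmxA -(mulmxA _ M) mulmxV// mulmx1.
    exact: mulmxV.
  by rewrite mulmxA mulmxV// mul1mx mulVmx.
rewrite mulmxA -(mulmxA u0^T M) -(mulmxA u0^T (_ *m _)) GE mulmx1 scalerA mxE -dotE.
by rewrite -enorm_sqr u0_unit expr1n mulr1 expr2.
Qed.

End Gram.

Lemma leif_sqrt_l1norm (R : realType) (n : nat) (w : 'rV[R]_n) :
  0 <= \sum_j w 0 j ->
  Num.sqrt (\sum_j w 0 j) <= Num.sqrt (l1norm w) ?= iff [forall j, 0 <= w 0 j].
Proof.
move=> w0.
have [le_w eq_w] : \sum_j w 0 j <= l1norm w ?= iff [forall j, 0 <= w 0 j].
  by apply: leif_sum => j _; apply: real_leif_norm; exact: num_real.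
split; first exact: ler_wsqrtr.
by rewrite -eq_w eqr_sqrt// (le_trans w0).
Qed.

Theorem theorem4 (R : realType) (n : nat) (v : 'I_n.+1 -> 'cV[R]_n)
    (u u0 : 'cV[R]_n)
    (v_indep : affinely_independent v) (v0 : v ord0 = 0)
    (u_unit : enorm u = 1)
    (v_above : forall i, i != ord0 -> 0 < dot u (v i))
    (upper : forall i, upper_facet (simplex v) u (facet v i) <-> i = ord0)
    (u0_normal : outward_unit_normal (simplex v) (facet v ord0) u0) :
  let S := simplex v in
  let SH := reflection u @` S in
  let s := \sum_(j < n) v (lift ord0 j) in
  let M := \matrix_(i < n, j < n) v (lift ord0 j) i 0 in
  let G := M^T *m M in
  let w : 'rV[R]_n := const_mx 1 *m invmx G in
  let ratio := ((Vol S)^-1 * Vol (convex_hull (S `|` SH)))%E in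
  let bound := n%:R * (1 + enorm s / dot u0 s) in
  let s' := (enorm s)^-1 *: s in
  [/\ (ratio <= bound%:E)%E,
      bound = n%:R + Num.sqrt (\sum_(j < n) w 0 j) *
                     enorm (M *m const_mx 1),
      bound <= n%:R + Num.sqrt (l1norm w) * enorm (M *m const_mx 1)
        ?= iff [forall j, 0 <= w 0 j] &
      ratio = bound%:E <-> u = (enorm (u0 + s'))^-1 *: (u0 + s')].
Proof.
case: n v u u0 v_indep v0 u_unit v_above upper u0_normal => [|m] v u u0 v_indep v0
  u_unit v_above upper u0_normal S SH s M G w ratio bound s'.
  by move: u_unit; rewrite /enorm /dot big_ord0 sqrtr0 => /eqP; rewrite eq_sym oner_eq0.
have [b b0 ub] := outward_normal_vertices v0 v_indep u0_normal.
have u0_unit : enorm u0 = 1 by case: u0_normal.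
have uM : M \in unitmx by rewrite unitmxE unitfE (det_vertex_mx v0 v_indep).
have above j : 0 < dot u (v (lift ord0 j)) by exact: v_above.
have coord i : 0 <= (invmx M *m u) i 0.
  rewrite leNgt; apply/negP => /(upper_facet_lift v0 v_indep) /upper /eqP.
  by rewrite eq_sym (negPf (neq_lift _ _)).
have us0 : 0 < dot u s.
  rewrite dot_sumr (bigD1 ord0)//= ltr_pwDl// sumr_ge0// => j _; exact: ltW.
have u0s : dot u0 s = m.+1%:R * b.
  rewrite dot_sumr; under eq_bigr do rewrite ub.
  by rewrite sumr_const card_ord mulr_natl.
have u0u : dot u0 u = b * \sum_i (invmx M *m u) i 0.
  rewrite -{1}(mulKVmx uM u) (dot_vertex_mx v) mulr_sumr.
  by apply: eq_bigr => j _; rewrite ub.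
have b_neq0 : b != 0 by rewrite gt_eqF.
have boundE : bound = (dot u0 s + enorm s) / b.
  have : m.+1%:R != 0 :> R by rewrite pnatr_eq0.
  by rewrite /bound u0s; move: (m.+1%:R) => N N0; field; rewrite b_neq0.
have ratioE : ratio = (2 * dot u0 u * dot u s / b)%:E.
  rewrite /ratio (@Vol_hull_ratio R m v u)// u0u; congr (_%:E).
  by rewrite -/s; field.
have wE : \sum_j w 0 j = b^-1 ^+ 2.
  apply: (sum_inv_gram uM u0_unit b0); apply/rowP => j.
  by rewrite !mxE mulr1 -(ub j); apply: eq_bigr => i _; rewrite !mxE.
have sE : M *m const_mx 1 = s by exact: (vertex_mx_const1 v).
have bound_w : bound = m.+1%:R + Num.sqrt (\sum_j w 0 j) * enorm s.
  by rewrite wE sqrtr_sqr gtr0_norm ?invr_gt0// boundE u0s; field.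
split.
- by rewrite ratioE boundE lee_fin ler_pM2r ?invr_gt0// bisector_bound.
- by rewrite sE.
- have s_gt0 : 0 < enorm s.
    by rewrite enorm_gt0; apply: contraTneq us0 => ->; rewrite dot0r ltxx.
  have w0 : 0 <= \sum_j w 0 j by rewrite wE sqr_ge0.
  have [le_w eq_w] := leif_sqrt_l1norm w0.
  rewrite bound_w sE; split; first by rewrite lerD2l ler_pM2r.
  by rewrite -eq_w (inj_eq (addrI _)) (inj_eq (mulIf _))// gt_eqF.
- rewrite ratioE boundE -(bisector_direction u_unit u0_unit us0).
  rewrite -(bisector_bound_eq u_unit u0_unit us0).
  split=> [[/(mulIf _)->//]|->//].
  by rewrite invr_eq0.
Qed.
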